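(* Let $A=A^T\in\mathbb R^{n\times n}$ and fix a block step $i\ge 1$ of the finite-precision variable-block Lanczos process described in the context, with $Y_i=\operatorname{fl}(A\widetilde V_i)$, $\widehat A_i=\operatorname{fl}(\widetilde V_i^TY_i)$, $A_i$ formed by the averaging rule, and $R_i=\operatorname{fl}(Y_i-\widetilde V_{i-1}B_i^T-\widetilde V_iA_i)$. Suppose the arithmetic assumption and the orthogonalization-and-truncation assumption of the context hold at step $i$, and that $$\delta_i<\tfrac12,\qquad \eta_i<\tfrac12,\qquad \ell_i^{\rm qr}>0 .$$ Then $A_i=A_i^T$, and the following statements hold. There is a matrix $\widetilde F_i\in\mathbb R^{n\times r_i}$ such that $$A\widetilde V_i=\widetilde V_{i-1}B_i^T+\widetilde V_iA_i+\widetilde V_{i+1}B_{i+1}+\widetilde F_i,\qquad \|\widetilde F_i\|_2\le c_i+h_i+\kappa_i^{\rm tail}\tau_i+\varepsilon_i^R .$$ The two adjacent-block products satisfy $$\max\left\{\|B_{i+1}\widetilde V_i^T\widetilde V_{i+1}\|_2,\ \|\widetilde V_i^T\widetilde V_{i+1}B_{i+1}\|_2\right\}\le q_i .$$ The next block satisfies $$\|\widetilde V_{i+1}^T\widetilde V_{i+1}-I\|_2\le\eta_i<\tfrac12 .$$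
   Context: Notation: $u$ is the unit roundoff, $\gamma_s=su/(1-su)$ for $su<1$, $\operatorname{fl}$ denotes a floating-point evaluation, $|X|$ is the componentwise absolute value, $\|\cdot\|_2$ is the spectral norm. At block step $i$ the stored current block is $\widetilde V_i\in\mathbb R^{n\times r_i}$, the previous one is $\widetilde V_{i-1}\in\mathbb R^{n\times r_{i-1}}$, and the stored coupling is $B_i\in\mathbb R^{r_i\times r_{i-1}}$. For $i=1$: $\widetilde V_0B_1^T=0$, $r_0=0$, $\gamma_0=0$. Averaging rule: $(A_i)_{ab}=(A_i)_{ba}=\operatorname{fl}\big(((\widehat A_i)_{ab}+(\widehat A_i)_{ba})/2\big)$ for $1\le a\le b\le r_i$. Stored products: $\widehat P_i^-=\operatorname{fl}(\widetilde V_{i-1}B_i^T)$, $\widehat P_i^0=\operatorname{fl}(\widetilde V_iA_i)$. Error quantities: $$\varepsilon_i^A=\|\gamma_n|A||\widetilde V_i|\|_2,\qquad \varepsilon_i^\alpha=\|\widetilde V_i\|_2\varepsilon_i^A+\|\gamma_n|\widetilde V_i|^T|Y_i|\|_2+\left\|\tfrac u2(|\widehat A_i|+|\widehat A_i|^T)\right\|_2,$$ $$\varepsilon_i^R=\varepsilon_i^A+\bigl\|\gamma_{r_{i-1}}|\widetilde V_{i-1}||B_i|^T+\gamma_{r_i}|\widetilde V_i||A_i|+\gamma_2(|Y_i|+|\widehat P_i^-|+|\widehat P_i^0|)\bigr\|_2 .$$ Arithmetic assumption (step $i$): no underflow or overflow; $nu<1$, $r_iu<1$, $r_{i-1}u<1$,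 $2u<1$. Every stored matrix product at this step with inner dimension $s$ satisfies $|\operatorname{fl}(XY)-XY|\le\gamma_s|X||Y|$ componentwise. For stored $Y,P,Q$, the two successive subtractions satisfy $|\operatorname{fl}(Y-P-Q)-(Y-P-Q)|\le\gamma_2(|Y|+|P|+|Q|)$. Each averaging operation satisfies $|\operatorname{fl}((a+b)/2)-(a+b)/2|\le\frac u2(|a|+|b|)$. Threshold: for a fixed positive multiplier $\vartheta$ chosen before the computation, $\tau_i=\vartheta u\max\{\|A\|_2,\|\operatorname{fl}(A\widetilde V_i)\|_2,\|B_i\|_2,\|R_i\|_2\}$. Orthogonalization-and-truncation assumption (step $i$): $1\le r_i\le n$. There are an orthogonal matrix $[Q_i,Q_{i,\perp}]\in\mathbb R^{n\times n}$, an upper triangular $R_{i,11}\in\mathbb R^{r_i\times r_i}$, and $E_i^V,E_i^H\in\mathbb R^{n\times r_i}$ with $$\widetilde V_i+E_i^V=Q_iR_{i,11},\quad \|E_i^V\|_2\le a_i^V\|\widetilde V_i\|_2,$$ $$\begin{bmatrix} C_i \\ G_i \end{bmatrix}=[Q_i,Q_{i,\perp}]^T(R_i+E_i^H),\quad \|E_i^H\|_2\le a_i^H\|R_i\|_2,$$ $C_i\in\mathbb R^{r_i\times r_i}$, $G_i\in\mathbb R^{(n-r_i)\times r_i}$. The singular values used for the rank decision are the exact singular values of $G_i+E_i^{\rm sv}$ with $\|E_i^{\rm sv}\|_2\le a_i^{\rm sv}\|G_i\|_2$. Let $r_{i+1}\ge0$ be the number of retained left singular vectors and $d_i\ge0$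 the number of discarded directions. There are $U_{i,J}\in\mathbb R^{(n-r_i)\times r_{i+1}}$, $U_{i,D}\in\mathbb R^{(n-r_i)\times d_i}$, a diagonal $\Sigma_{i,D}\in\mathbb R^{d_i\times d_i}$ with nonnegative entries, $Z_{i,D}\in\mathbb R^{r_i\times d_i}$, $B_{i+1}\in\mathbb R^{r_{i+1}\times r_i}$, $E_i^S\in\mathbb R^{(n-r_i)\times r_i}$, $E_i^M\in\mathbb R^{n\times r_{i+1}}$ with $$G_i=U_{i,J}B_{i+1}+U_{i,D}\Sigma_{i,D}Z_{i,D}^T+E_i^S,\quad \|E_i^S\|_2\le a_i^S\|G_i\|_2,$$ $$\widetilde V_{i+1}=Q_{i,\perp}U_{i,J}+E_i^M,\quad \|E_i^M\|_2\le a_i^M .$$ If $r_{i+1}>0$: $\operatorname{rank}(B_{i+1})=r_{i+1}$ and $\|B_{i+1}\|_2\le(1+a_i^S)\|G_i\|_2$. Finally $\|U_{i,J}^TU_{i,J}-I\|_2\le a_i^U$, $\|U_{i,D}^TU_{i,D}-I\|_2\le a_{i,D}^U$, $\|Z_{i,D}^TZ_{i,D}-I\|_2\le a_{i,D}^Z$, and every diagonal entry of $\Sigma_{i,D}$ is at most $\tau_i$. All the constants $a$ are nonnegative and independent of $\sigma_{\min}(B_{i+1})$. Derived quantities: $$\eta_i=a_i^U+2\sqrt{1+a_i^U}\,a_i^M+(a_i^M)^2,\qquad \kappa_i^{\rm tail}=\sqrt{1+a_{i,D}^U}\sqrt{1+a_{i,D}^Z},$$ $$h_i=\left[a_i^H+a_i^S(1+a_i^H)+a_i^M(1+a_i^S)(1+a_i^H)\right]\|R_i\|_2,$$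 $$\delta_i=\|\widetilde V_i^T\widetilde V_i-I\|_2,\quad \rho_i^-=\|B_i\widetilde V_{i-1}^T\widetilde V_i\|_2\ (\rho_1^-=0),\quad \ell_i^{\rm qr}=\sqrt{1-\delta_i}-a_i^V\sqrt{1+\delta_i},\quad \kappa_i=(\ell_i^{\rm qr})^{-1},$$ $$c_i=\kappa_i\bigl(\rho_i^-+\varepsilon_i^\alpha+\delta_i\|A_i\|_2+\sqrt{1+\delta_i}\,\varepsilon_i^R+a_i^V\sqrt{1+\delta_i}\,\|R_i\|_2\bigr)+a_i^H\|R_i\|_2,$$ $$q_i=\left(a_i^V\|\widetilde V_i\|_2\sqrt{1+a_i^U}+a_i^M\|\widetilde V_i\|_2\right)\|B_{i+1}\|_2 .$$ *)

(* Defs.v *)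
From HB Require Import structures.
From mathcomp Require Import all_boot all_order all_algebra.
From mathcomp Require Import all_classical all_reals.

Set Implicit Arguments.
Unset Strict Implicit.
Unset Printing Implicit Defensive.

Import Order.TTheory GRing.Theory Num.Theory.
Local Open Scope classical_set_scope.
Local Open Scope ring_scope.

(* Euclidean norm of a vector and the operator norm it induces on matrices.
   The supremum is over the closed unit ball, so that the norm is also
   meaningful (and is 0) for matrices with an empty dimension. *)
Definition vnorm2 (R : realType) (m : nat) (x : 'cV[R]_m) : R :=
  Num.sqrt (\sum_(k < m) x k 0 ^+ 2).

Definition norm2 (R : realType) (m p : nat) (X : 'M[R]_(m, p)) : R :=
  sup [set vnorm2 (X *m x) | x in [set x : 'cV[R]_p | vnorm2 x <= 1]].

Definition absmx (R : realType) (m p : nat) (X : 'M[R]_(m, p)) : 'M[R]_(m, p) :=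
  map_mx (fun x => `|x|) X.

Definition lemx (R : realType) (m p : nat) (X Y : 'M[R]_(m, p)) : Prop :=
  forall a b, X a b <= Y a b.

(* Both identities are required: the index types of rows and columns are only
   provably (not syntactically) of the same size for [row_mx Q Qperp] below. *)
Definition orthogonal_mx (R : realType) (m p : nat) (X : 'M[R]_(m, p)) : Prop :=
  X^T *m X = 1%:M /\ X *m X^T = 1%:M.

(* [s] lists the singular values of [M], with multiplicity, in nonincreasing
   order. *)
Definition singular_values (R : realType) (m p : nat) (M : 'M[R]_(m, p))
    (s : seq R) : Prop :=
  [/\ size s = minn m p, sorted >=%R s, {in s, forall x, 0 <= x} &
      exists (U : 'M[R]_m) (W : 'M[R]_p),
        [/\ orthogonal_mx U, orthogonal_mx W &
            M = U *m (\matrix_(a < m, b < p) (if a == b :> nat then s`_a else 0))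
                  *m W^T]].

Definition gammaf (R : realType) (u : R) (s : nat) : R :=
  s%:R * u / (1 - s%:R * u).

(* The floating-point evaluations used by the process: a matrix product, a
   matrix subtraction and the scalar average (x + y) / 2. These are arbitrary
   functions; accuracy is assumed only for the evaluations performed at the
   step under study (see [arithmetic_assumption]). *)
Record fl_ops (R : realType) := FlOps {
  fl_mul : forall m s p, 'M[R]_(m, s) -> 'M[R]_(s, p) -> 'M[R]_(m, p);
  fl_sub : forall m p, 'M[R]_(m, p) -> 'M[R]_(m, p) -> 'M[R]_(m, p);
  fl_avg : R -> R -> R
}.

(* The stored blocks V_i and couplings B_i. Since r_0 = 0, the block V_0 is
   empty, and the conventions V_0 B_1^T = 0, gamma_(r_0) = 0 and rho_1^- = 0
   hold automatically. The matrix [bV 0] is empty and [bB 0] is a 0 x 0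
   matrix. *)
Record blocks (R : realType) (n : nat) := Blocks {
  br : nat -> nat;
  bV : forall i, 'M[R]_(n, br i);
  bB : forall i, 'M[R]_(br i, br i.-1);
  br0 : br 0 = 0%N
}.

(* The constants of the orthogonalization and truncation at one step. *)
Record ot_consts (R : realType) := OtConsts {
  aV : R;
  aH : R;
  asv : R;
  aS : R;
  aM : R;
  aU : R;
  aUD : R;
  aZD : R
}.

Section Lanczos_step.

Context (R : realType) (n : nat) (u theta : R) (fl : fl_ops R) (A : 'M[R]_n)
  (D : blocks R n) (a : ot_consts R) (i : nat).

Local Notation r := (br D).
Local Notation V := (bV D).
Local Notation B := (bB D).
Local Notation gamma := (gammaf u).

Definition Ystored : 'M[R]_(n, r i) := fl_mul fl A (V i).

Definition Ahat : 'M[R]_(r i) := fl_mul fl (V i)^T Ystored.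

Definition Acoef : 'M[R]_(r i) :=
  \matrix_(k, l) if (k <= l)%N then fl_avg fl (Ahat k l) (Ahat l k)
                 else fl_avg fl (Ahat l k) (Ahat k l).

Definition Pminus : 'M[R]_(n, r i) := fl_mul fl (V i.-1) (B i)^T.

Definition Pzero : 'M[R]_(n, r i) := fl_mul fl (V i) Acoef.

Definition Rres : 'M[R]_(n, r i) := fl_sub fl (fl_sub fl Ystored Pminus) Pzero.

Definition mul_accurate (m s p : nat) (X : 'M[R]_(m, s)) (Y : 'M[R]_(s, p)) :
    Prop :=
  lemx (absmx (fl_mul fl X Y - X *m Y)) (gamma s *: (absmx X *m absmx Y)).

(* Absence of underflow and overflow enters only through these bounds. *)
Definition arithmetic_assumption : Prop :=
  [/\ [/\ n%:R * u < 1, (r i)%:R * u < 1, (r i.-1)%:R * u < 1 & 2 * u < 1],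
      [/\ mul_accurate A (V i), mul_accurate (V i)^T Ystored,
          mul_accurate (V i.-1) (B i)^T & mul_accurate (V i) Acoef],
      lemx (absmx (Rres - (Ystored - Pminus - Pzero)))
           (gamma 2 *: (absmx Ystored + absmx Pminus + absmx Pzero)) &
      forall k l : 'I_(r i), (k <= l)%N ->
        `|fl_avg fl (Ahat k l) (Ahat l k) - (Ahat k l + Ahat l k) / 2|
          <= u / 2 * (`|Ahat k l| + `|Ahat l k|)].

Definition eps_A : R := norm2 (gamma n *: (absmx A *m absmx (V i))).

Definition eps_alpha : R :=
  norm2 (V i) * eps_A
  + norm2 (gamma n *: ((absmx (V i))^T *m absmx Ystored))
  + norm2 ((u / 2) *: (absmx Ahat + (absmx Ahat)^T)).

Definition eps_R : R :=
  eps_A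
  + norm2 (gamma (r i.-1) *: (absmx (V i.-1) *m (absmx (B i))^T)
           + gamma (r i) *: (absmx (V i) *m absmx Acoef)
           + gamma 2 *: (absmx Ystored + absmx Pminus + absmx Pzero)).

Definition tau : R :=
  theta * u * Num.max (Num.max (norm2 A) (norm2 Ystored))
                      (Num.max (norm2 (B i)) (norm2 Rres)).

(* Rank-revealing orthogonalization and truncation of the residual. The list
   [ot_sv] holds the singular values consulted by the rank decision; it returns
   [br D i.+1] retained and [ot_d] discarded directions, and the threshold
   [tau] bounds the diagonal of [ot_SigmaD]. *)
Record ortho_trunc : Type := OrthoTrunc {
  ot_Q : 'M[R]_(n, r i);
  ot_Qperp : 'M[R]_(n, n - r i);
  ot_R11 : 'M[R]_(r i);
  ot_EV : 'M[R]_(n, r i);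
  ot_EH : 'M[R]_(n, r i);
  ot_C : 'M[R]_(r i);
  ot_G : 'M[R]_(n - r i, r i);
  ot_Esv : 'M[R]_(n - r i, r i);
  ot_sv : seq R;
  ot_d : nat;
  ot_UJ : 'M[R]_(n - r i, r i.+1);
  ot_UD : 'M[R]_(n - r i, ot_d);
  ot_SigmaD : 'M[R]_ot_d;
  ot_ZD : 'M[R]_(r i, ot_d);
  ot_ES : 'M[R]_(n - r i, r i);
  ot_EM : 'M[R]_(n, r i.+1);

  ot_consts_ge0 : [/\ [/\ 0 <= aV a, 0 <= aH a, 0 <= asv a & 0 <= aS a],
                      0 <= aM a, 0 <= aU a, 0 <= aUD a & 0 <= aZD a];
  ot_rank_range : (1 <= r i <= n)%N;

  ot_Q_orth : orthogonal_mx (row_mx ot_Q ot_Qperp);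
  ot_R11_upper : forall k l : 'I_(r i), (l < k)%N -> ot_R11 k l = 0;
  ot_qr : V i + ot_EV = ot_Q *m ot_R11;
  ot_EV_le : norm2 ot_EV <= aV a * norm2 (V i);

  ot_CG : col_mx ot_C ot_G = (row_mx ot_Q ot_Qperp)^T *m (Rres + ot_EH);
  ot_EH_le : norm2 ot_EH <= aH a * norm2 Rres;

  ot_sv_exact : singular_values (ot_G + ot_Esv) ot_sv;
  ot_Esv_le : norm2 ot_Esv <= asv a * norm2 ot_G;

  ot_G_split : ot_G = ot_UJ *m B i.+1 + ot_UD *m ot_SigmaD *m ot_ZD^T + ot_ES;
  ot_ES_le : norm2 ot_ES <= aS a * norm2 ot_G;
  ot_Vnext : V i.+1 = ot_Qperp *m ot_UJ + ot_EM;
  ot_EM_le : norm2 ot_EM <= aM a;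
  ot_Bnext : (0 < r i.+1)%N ->
    \rank (B i.+1) = r i.+1 /\ norm2 (B i.+1) <= (1 + aS a) * norm2 ot_G;

  ot_UJ_orth : norm2 (ot_UJ^T *m ot_UJ - 1%:M) <= aU a;
  ot_UD_orth : norm2 (ot_UD^T *m ot_UD - 1%:M) <= aUD a;
  ot_ZD_orth : norm2 (ot_ZD^T *m ot_ZD - 1%:M) <= aZD a;
  ot_SigmaD_diag : is_diag_mx ot_SigmaD;
  ot_SigmaD_range : forall k, 0 <= ot_SigmaD k k <= tau
}.

Definition eta_next : R := aU a + 2 * Num.sqrt (1 + aU a) * aM a + aM a ^+ 2.

Definition kappa_tail : R := Num.sqrt (1 + aUD a) * Num.sqrt (1 + aZD a).

Definition h_bound : R :=
  (aH a + aS a * (1 + aH a) + aM a * (1 + aS a) * (1 + aH a)) * norm2 Rres.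

Definition delta : R := norm2 ((V i)^T *m V i - 1%:M).

Definition rho_minus : R := norm2 (B i *m (V i.-1)^T *m V i).

Definition ell_qr : R := Num.sqrt (1 - delta) - aV a * Num.sqrt (1 + delta).

Definition kappa : R := ell_qr^-1.

Definition c_bound : R :=
  kappa * (rho_minus + eps_alpha + delta * norm2 Acoef
           + Num.sqrt (1 + delta) * eps_R
           + aV a * Num.sqrt (1 + delta) * norm2 Rres)
  + aH a * norm2 Rres.

Definition q_bound : R :=
  (aV a * norm2 (V i) * Num.sqrt (1 + aU a) + aM a * norm2 (V i))
  * norm2 (B i.+1).

End Lanczos_step.

(* Main.v *)
(* Since [Q, Qperp] is orthogonal, R = Q C + Qperp G - E^H. Substituting the
   truncated splitting of G, the term Qperp U_J B_(i+1) becomes V_(i+1) B_(i+1)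
   and the remaining terms are the truncation error; only Q C is not small by
   assumption. Now R_11 is bounded below by ell^qr, so Q = (V + E^V) R_11^-1
   turns ||C|| into kappa ||V^T R||, up to the QR errors. Finally V^T R reduces to
   the adjacent-block product, the loss of orthogonality and rounding errors,
   because A_i is, up to rounding, the symmetric part of V^T fl(A V), and
   V^T A V is symmetric. *)
Require Import Defs.
From HB Require Import structures.
From mathcomp Require Import all_boot all_order all_algebra.
From mathcomp Require Import all_classical all_reals.
From mathcomp Require Import lra ring.

Import Order.TTheory GRing.Theory Num.Theory.
Local Open Scope ring_scope.

Set Implicit Arguments.
Unset Strict Implicit.

(** * Spectral norm *)

Section EuclideanNorm.
Variable R : realType.

Definition dot (m : nat) (x y : 'cV[R]_m) : R := (x^T *m y) 0 0.

Lemma dotE m (x y : 'cV[R]_m) : dot x y = \sum_k x k 0 * y k 0.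
Proof. by rewrite /dot mxE; apply: eq_bigr => k _; rewrite mxE. Qed.

Lemma dotC m (x y : 'cV[R]_m) : dot x y = dot y x.
Proof. by rewrite !dotE; apply: eq_bigr => k _; rewrite mulrC. Qed.

Lemma dotDr m (x y z : 'cV[R]_m) : dot x (y + z) = dot x y + dot x z.
Proof. by rewrite /dot mulmxDr mxE. Qed.

Lemma dotDl m (x y z : 'cV[R]_m) : dot (x + y) z = dot x z + dot y z.
Proof. by rewrite !(dotC _ z) dotDr. Qed.

Lemma dot_adjoint m p (X : 'M[R]_(m, p)) x y : dot (X *m x) y = dot x (X^T *m y).
Proof. by rewrite /dot trmx_mul mulmxA. Qed.

Lemma dot_mulmx m p (X : 'M[R]_(m, p)) x :
  dot (X *m x) (X *m x) = dot x ((X^T *m X) *m x).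
Proof. by rewrite dot_adjoint mulmxA. Qed.

Lemma vnorm2_ge0 m (x : 'cV[R]_m) : 0 <= vnorm2 x.
Proof. exact: sqrtr_ge0. Qed.

Lemma sqr_vnorm2 m (x : 'cV[R]_m) : vnorm2 x ^+ 2 = dot x x.
Proof.
rewrite /vnorm2 sqr_sqrtr; last by apply: sumr_ge0 => k _; rewrite sqr_ge0.
by rewrite dotE.
Qed.

Lemma vnorm2_eq0 m (x : 'cV[R]_m) : vnorm2 x = 0 -> x = 0.
Proof.
move=> x0; have := sqr_vnorm2 x; rewrite x0 expr0n /= dotE => /esym/eqP.
rewrite psumr_eq0 => [/allP x0k|k _]; last by rewrite -expr2 sqr_ge0.
apply/matrixP => k j; rewrite ord1 mxE; apply/eqP.
by have := x0k k (mem_index_enum _); rewrite /= mulf_eq0 orbb.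
Qed.

Lemma vnorm2_gt0 m (x : 'cV[R]_m) : x != 0 -> 0 < vnorm2 x.
Proof.
by move=> x0; rewrite lt0r vnorm2_ge0 andbT; apply: contra x0 => /eqP/vnorm2_eq0->.
Qed.

Lemma vnorm20 m : vnorm2 (0 : 'cV[R]_m) = 0.
Proof.
apply/eqP; rewrite -sqrf_eq0 sqr_vnorm2 dotE big1 // => k _.
by rewrite mxE mul0r.
Qed.

Lemma le_vnorm2_sqr m (x : 'cV[R]_m) c : 0 <= c -> (vnorm2 x <= c) = (dot x x <= c ^+ 2).
Proof. by move=> c0; rewrite -sqr_vnorm2 ler_pXn2r // nnegrE ?vnorm2_ge0. Qed.

(** Cauchy-Schwarz: with [s] and [t] the norms of [x] and [y], the squared norm of [t x - s y] is
    [2 s t (s t - dot x y)], and it is nonnegative. Zero vectors are set apart so that [2 s t] can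
    be cancelled. *)
Lemma dot_le m (x y : 'cV[R]_m) : dot x y <= vnorm2 x * vnorm2 y.
Proof.
have [->|x0] := eqVneq x 0; first by rewrite /dot trmx0 mul0mx mxE vnorm20 mul0r.
have [->|y0] := eqVneq y 0; first by rewrite /dot mulmx0 mxE vnorm20 mulr0.
have := vnorm2_gt0 x0; have := vnorm2_gt0 y0.
set s := vnorm2 x; set t := vnorm2 y => t0 s0.
have h : 0 <= \sum_k (t * x k 0 - s * y k 0) ^+ 2.
  by apply: sumr_ge0 => k _; rewrite sqr_ge0.
have e : \sum_k (t * x k 0 - s * y k 0) ^+ 2
         = 2 * (s * t) * (s * t - dot x y).
  transitivity (t ^+ 2 * dot x x + s ^+ 2 * dot y y - 2 * (s * t) * dot x y).
    rewrite !dotE !mulr_sumr -big_split -sumrB /=; apply: eq_bigr => k _.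
    by ring.
  by rewrite -!sqr_vnorm2 -/s -/t; ring.
by move: h; rewrite e pmulr_rge0 ?subr_ge0 // !mulr_gt0.
Qed.

Lemma vnorm2_leD m (x y : 'cV[R]_m) : vnorm2 (x + y) <= vnorm2 x + vnorm2 y.
Proof.
rewrite le_vnorm2_sqr ?addr_ge0 ?vnorm2_ge0 // dotDl !dotDr (dotC y x).
have := dot_le x y; rewrite sqrrD !sqr_vnorm2; lra.
Qed.

Lemma vnorm2Z m c (x : 'cV[R]_m) : vnorm2 (c *: x) = `|c| * vnorm2 x.
Proof.
apply/eqP; rewrite -(@eqrXn2 _ 2) ?mulr_ge0 ?vnorm2_ge0 //.
rewrite exprMn !sqr_vnorm2 real_normK ?num_real // !dotE mulr_sumr.
by apply/eqP/eq_bigr => k _; rewrite !mxE; ring.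
Qed.

Lemma vnorm2N m (x : 'cV[R]_m) : vnorm2 (- x) = vnorm2 x.
Proof. by rewrite -scaleN1r vnorm2Z normrN1 mul1r. Qed.

Lemma vnorm2_le_abs m (x y : 'cV[R]_m) :
  (forall k, `|x k 0| <= y k 0) -> vnorm2 x <= vnorm2 y.
Proof.
move=> xy; apply: ler_wsqrtr; apply: ler_sum => k _.
by rewrite -[x k 0 ^+ 2]real_normK ?num_real // ler_pXn2r ?nnegrE ?(le_trans _ (xy k)).
Qed.

Lemma vnorm2_absmx m (x : 'cV[R]_m) : vnorm2 (absmx x) = vnorm2 x.
Proof.
by rewrite /vnorm2; congr Num.sqrt; apply: eq_bigr => k _; rewrite mxE real_normK ?num_real.
Qed.

Lemma vnorm2_isometry m p (X : 'M[R]_(m, p)) x :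
  X^T *m X = 1%:M -> vnorm2 (X *m x) = vnorm2 x.
Proof.
move=> XX; apply/eqP; rewrite -(@eqrXn2 _ 2) ?vnorm2_ge0 // !sqr_vnorm2.
by rewrite dot_mulmx XX mul1mx.
Qed.

End EuclideanNorm.

(** * The induced operator norm: existence of the supremum, algebraic rules, isometries *)

Section SpectralNorm.
Variable R : realType.

(** A crude bound, the sum of the column norms, is enough: it only serves to show that the supremum
    defining [norm2] is over a bounded set. *)
Lemma vnorm2_mulmx_bounded m p (X : 'M[R]_(m, p)) :
  exists2 K, 0 <= K & forall x, vnorm2 (X *m x) <= K * vnorm2 x.
Proof.
exists (\sum_l vnorm2 (col l X)); first by apply: sumr_ge0 => l _; exact: vnorm2_ge0.
move=> x; have -> : X *m x = \sum_l x l 0 *: col l X.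
  apply/matrixP => k j; rewrite mxE summxE; apply: eq_bigr => l _.
  by rewrite !mxE ord1 mulrC.
have tri (s : seq 'I_p) : vnorm2 (\sum_(l <- s) x l 0 *: col l X)
    <= \sum_(l <- s) vnorm2 (x l 0 *: col l X).
  elim: s => [|l s IH]; first by rewrite !big_nil vnorm20.
  by rewrite !big_cons (le_trans (vnorm2_leD _ _)) ?lerD2l.
rewrite (le_trans (tri _)) // mulr_suml ler_sum // => l _.
rewrite vnorm2Z mulrC ler_wpM2l ?vnorm2_ge0 //.
rewrite -(@ler_pXn2r _ 2) ?nnegrE ?vnorm2_ge0 // real_normK ?num_real //.
rewrite sqr_vnorm2 dotE (bigD1 l) //= -expr2 lerDl.
by apply: sumr_ge0 => k _; rewrite -expr2 sqr_ge0.
Qed.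

Lemma norm2_has_sup m p (X : 'M[R]_(m, p)) :
  has_sup [set vnorm2 (X *m x) | x in [set x : 'cV[R]_p | vnorm2 x <= 1]]%classic.
Proof.
split; first by exists (vnorm2 (X *m 0)), 0 => //=; rewrite vnorm20.
have [K K0 XK] := vnorm2_mulmx_bounded X.
by exists K => _ [x /= x1 <-]; rewrite (le_trans (XK x)) // ler_piMr.
Qed.

Lemma norm2_ge0 m p (X : 'M[R]_(m, p)) : 0 <= norm2 X.
Proof.
apply: (@le_trans _ _ (vnorm2 (X *m 0))); first exact: vnorm2_ge0.
apply: sup_upper_bound; first exact: norm2_has_sup.
by exists 0 => //=; rewrite vnorm20.
Qed.

Lemma vnorm2_mulmx_le m p (X : 'M[R]_(m, p)) x :
  vnorm2 (X *m x) <= norm2 X * vnorm2 x.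
Proof.
have [->|x0] := eqVneq x 0; first by rewrite mulmx0 !vnorm20 mulr0.
have x_gt0 := vnorm2_gt0 x0.
rewrite -ler_pdivrMr // mulrC.
have -> : (vnorm2 x)^-1 * vnorm2 (X *m x) = vnorm2 (X *m ((vnorm2 x)^-1 *: x)).
  by rewrite -scalemxAr vnorm2Z gtr0_norm ?invr_gt0.
apply: sup_upper_bound; first exact: norm2_has_sup.
by eexists; [|reflexivity]; rewrite /= vnorm2Z gtr0_norm ?invr_gt0 // mulVf ?gt_eqF.
Qed.

Lemma norm2_le m p (X : 'M[R]_(m, p)) K : 0 <= K ->
  (forall x, vnorm2 (X *m x) <= K * vnorm2 x) -> norm2 X <= K.
Proof.
move=> K0 XK; apply: ge_sup; first by have [] := norm2_has_sup X.
by move=> _ [x /= x1 <-]; rewrite (le_trans (XK x)) // ler_piMr.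
Qed.

Lemma norm2_leD m p (X Y : 'M[R]_(m, p)) : norm2 (X + Y) <= norm2 X + norm2 Y.
Proof.
apply: norm2_le => [|x]; first by rewrite addr_ge0 ?norm2_ge0.
by rewrite mulmxDl (le_trans (vnorm2_leD _ _)) // mulrDl lerD ?vnorm2_mulmx_le.
Qed.

Lemma norm2N m p (X : 'M[R]_(m, p)) : norm2 (- X) = norm2 X.
Proof.
have le Y : norm2 (- Y) <= norm2 Y :> R.
  move: Y => Y'; apply: norm2_le => [|x]; first exact: norm2_ge0.
  by rewrite mulNmx vnorm2N vnorm2_mulmx_le.
by apply/eqP; rewrite eq_le le /= -{1}[X]opprK le.
Qed.

Lemma norm2Z_le m p c (X : 'M[R]_(m, p)) : 0 <= c -> norm2 (c *: X) <= c * norm2 X.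
Proof.
move=> c0; apply: norm2_le => [|x]; first by rewrite mulr_ge0 ?norm2_ge0.
by rewrite -scalemxAl vnorm2Z ger0_norm // -mulrA ler_wpM2l ?vnorm2_mulmx_le.
Qed.

Lemma norm2M m p q (X : 'M[R]_(m, p)) (Y : 'M[R]_(p, q)) :
  norm2 (X *m Y) <= norm2 X * norm2 Y.
Proof.
apply: norm2_le => [|x]; first by rewrite mulr_ge0 ?norm2_ge0.
rewrite -mulmxA (le_trans (vnorm2_mulmx_le _ _)) // -mulrA.
by rewrite ler_wpM2l ?norm2_ge0 ?vnorm2_mulmx_le.
Qed.

Lemma norm2M_le m p q (X : 'M[R]_(m, p)) (Y : 'M[R]_(p, q)) x y :
  norm2 X <= x -> norm2 Y <= y -> norm2 (X *m Y) <= x * y.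
Proof.
by move=> Xx Yy; rewrite (le_trans (norm2M _ _)) // ler_pM ?norm2_ge0.
Qed.

(** With [z = X^T y], the square of the norm of [z] is the inner product of [y] and [X z], hence at
    most [norm2 X] times the norms of [y] and [z]; one factor of [z] cancels. *)
Lemma norm2_tr_le m p (X : 'M[R]_(m, p)) : norm2 X^T <= norm2 X.
Proof.
apply: norm2_le => [|y]; first exact: norm2_ge0.
have [z0|z0] := eqVneq (vnorm2 (X^T *m y)) 0.
  by rewrite z0 mulr_ge0 ?norm2_ge0 ?vnorm2_ge0.
have z_gt0 : 0 < vnorm2 (X^T *m y) by rewrite lt0r z0 vnorm2_ge0.
rewrite -(ler_pM2r z_gt0) -expr2 sqr_vnorm2 dot_adjoint trmxK.
rewrite (le_trans (dot_le _ _)) // mulrC mulrAC ler_wpM2r ?vnorm2_ge0 //.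
exact: vnorm2_mulmx_le.
Qed.

Lemma norm2_tr m p (X : 'M[R]_(m, p)) : norm2 X^T = norm2 X.
Proof. by apply/eqP; rewrite eq_le norm2_tr_le -{1}[X]trmxK norm2_tr_le. Qed.

(** The bridge from componentwise rounding bounds to spectral norms: entrywise, [X x] is dominated
    by [Y] applied to [absmx x], and [absmx x] is as long as [x]. *)
Lemma norm2_le_abs m p (X Y : 'M[R]_(m, p)) : lemx (absmx X) Y -> norm2 X <= norm2 Y.
Proof.
move=> XY; apply: norm2_le => [|x]; first exact: norm2_ge0.
rewrite -(vnorm2_absmx x) (le_trans _ (vnorm2_mulmx_le _ _)) //.
apply: vnorm2_le_abs => k; rewrite !mxE (le_trans (ler_norm_sum _ _ _)) //.
apply: ler_sum => l _; rewrite normrM mxE ler_wpM2r //.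
by have := XY k l; rewrite mxE.
Qed.

Lemma norm2_isometry_mul m p q (X : 'M[R]_(m, p)) (Y : 'M[R]_(p, q)) :
  X^T *m X = 1%:M -> norm2 (X *m Y) <= norm2 Y.
Proof.
move=> XX; apply: norm2_le => [|x]; first exact: norm2_ge0.
by rewrite -mulmxA vnorm2_isometry // vnorm2_mulmx_le.
Qed.

Lemma norm2_isometry_trmul m p q (X : 'M[R]_(m, p)) (Y : 'M[R]_(m, q)) :
  X^T *m X = 1%:M -> norm2 (X^T *m Y) <= norm2 Y.
Proof.
move=> XX; have X1 : norm2 X^T <= 1.
  rewrite norm2_tr norm2_le // => x.
  by rewrite vnorm2_isometry // mul1r.
by rewrite -[leRHS]mul1r norm2M_le.
Qed.

(** * Norm bounds from a nearly orthonormal Gram matrix, and inverses *)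

Lemma dot_gram m p (X : 'M[R]_(m, p)) x :
  vnorm2 (X *m x) ^+ 2 = vnorm2 x ^+ 2 + dot x ((X^T *m X - 1%:M) *m x).
Proof. by rewrite !sqr_vnorm2 dot_mulmx -dotDr mulmxBl mul1mx addrC subrK. Qed.

Lemma norm2_gram_le m p (X : 'M[R]_(m, p)) e :
  norm2 (X^T *m X - 1%:M) <= e -> norm2 X <= Num.sqrt (1 + e).
Proof.
move=> Xe; have e0 : 0 <= 1 + e.
  by rewrite addr_ge0 // (le_trans _ Xe) ?norm2_ge0.
apply: norm2_le => [|x]; first exact: sqrtr_ge0.
rewrite -(@ler_pXn2r _ 2) ?nnegrE ?mulr_ge0 ?sqrtr_ge0 ?vnorm2_ge0 //.
rewrite exprMn (sqr_sqrtr e0) mulrDl mul1r dot_gram lerD2l.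
rewrite (le_trans (dot_le _ _)) // mulrC expr2 mulrA ler_wpM2r ?vnorm2_ge0 //.
by rewrite (le_trans (vnorm2_mulmx_le _ _)) // ler_wpM2r ?vnorm2_ge0.
Qed.

(** The lower counterpart of [norm2_gram_le], from the same identity [dot_gram]. The bound by 1
    keeps the radicand nonnegative, so the square root can be squared away. *)
Lemma vnorm2_gram_ge m p (X : 'M[R]_(m, p)) x :
  norm2 (X^T *m X - 1%:M) <= 1 ->
  Num.sqrt (1 - norm2 (X^T *m X - 1%:M)) * vnorm2 x <= vnorm2 (X *m x).
Proof.
move=> X1; rewrite -(@ler_pXn2r _ 2) ?nnegrE ?mulr_ge0 ?sqrtr_ge0 ?vnorm2_ge0 //.
rewrite exprMn sqr_sqrtr ?subr_ge0 // dot_gram mulrBl mul1r lerD2l.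
rewrite lerNl; have -> : - dot x ((X^T *m X - 1%:M) *m x)
    = dot (- x) ((X^T *m X - 1%:M) *m x).
  by rewrite /dot linearN /= mulNmx [RHS]mxE.
rewrite (le_trans (dot_le _ _)) // vnorm2N mulrC expr2 mulrA.
by rewrite ler_wpM2r ?vnorm2_ge0 ?vnorm2_mulmx_le.
Qed.

Lemma unitmx_bounded_below p (X : 'M[R]_p) l : 0 < l ->
  (forall x, l * vnorm2 x <= vnorm2 (X *m x)) ->
  X \in unitmx /\ norm2 (invmx X) <= l^-1.
Proof.
move=> l0 Xl; have XU : X \in unitmx.
  (* [kermx] is a left kernel, so it is taken for [X^T]: the columns of its transpose are then
     annihilated by [X], and the lower bound forces them to vanish. *)
  rewrite -unitmx_tr -row_free_unit -kermx_eq0; apply/eqP/trmx_inj.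
  rewrite trmx0; apply/matrixP => k j.
  have : X *m col j (kermx X^T)^T = 0.
    rewrite colE mulmxA; have -> : X *m (kermx X^T)^T = 0; last exact: mul0mx.
    by apply: trmx_inj; rewrite trmx_mul trmxK mulmx_ker trmx0.
  move=> Xk0; have := Xl (col j (kermx X^T)^T); rewrite Xk0 vnorm20.
  rewrite pmulr_rle0 // => k_le0.
  have /vnorm2_eq0/matrixP/(_ k 0) : vnorm2 (col j (kermx X^T)^T) = 0.
    by apply/eqP; rewrite eq_le k_le0 vnorm2_ge0.
  by rewrite mxE => ->; rewrite !mxE.
split=> //; apply: norm2_le => [|x]; first by rewrite invr_ge0 ltW.
have := Xl (invmx X *m x); rewrite mulmxA mulmxV // mul1mx mulrC.
by rewrite -ler_pdivlMr // mulrC.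
Qed.

Lemma norm2_diag_le p (S : 'M[R]_p) t : 0 <= t -> is_diag_mx S ->
  (forall k, 0 <= S k k <= t) -> norm2 S <= t.
Proof.
move=> t0 /is_diag_mxP Sd St; apply: norm2_le => // x.
rewrite -(vnorm2_absmx x) -{1}(ger0_norm t0) -vnorm2Z.
apply: vnorm2_le_abs => k; rewrite !mxE (bigD1 k) //= big1 ?addr0; last first.
  by move=> l lk; rewrite Sd ?mul0r // eq_sym.
have /andP[S0 St1] := St k.
by rewrite normrM ger0_norm // ler_wpM2r.
Qed.

(** Lets the averaging of [Ahat] with its transpose be analysed without doubling the error of
    [Ahat]. *)
Lemma norm2_sym_part_le p (X : 'M[R]_p) : norm2 (2^-1 *: (X + X^T)) <= norm2 X.
Proof.
rewrite (le_trans (norm2Z_le _ _)) ?invr_ge0 //.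
have := norm2_leD X X^T; rewrite norm2_tr; lra.
Qed.

End SpectralNorm.

(** * The block Lanczos step *)

Lemma addmxE (R : realType) m p (X Y : 'M[R]_(m, p)) k l : (X + Y) k l = X k l + Y k l.
Proof. by rewrite mxE. Qed.

Lemma oppmxE (R : realType) m p (X : 'M[R]_(m, p)) k l : (- X) k l = - X k l.
Proof. by rewrite mxE. Qed.

Lemma absmx_tr (R : realType) m p (X : 'M[R]_(m, p)) : absmx X^T = (absmx X)^T.
Proof. by rewrite /absmx map_trmx. Qed.

Lemma absmxN (R : realType) m p (X : 'M[R]_(m, p)) : absmx (- X) = absmx X.
Proof. by apply/matrixP => k l; rewrite !mxE normrN. Qed.

Lemma lemx_absD (R : realType) m p (X Y M N : 'M[R]_(m, p)) :
  lemx (absmx X) M -> lemx (absmx Y) N -> lemx (absmx (X + Y)) (M + N).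
Proof.
move=> XM YN k l; have := XM k l; have := YN k l; rewrite !mxE => y x.
by rewrite (le_trans (ler_normD _ _)) // lerD.
Qed.

(** Only sums and opposites are unfolded entrywise, so that entries of matrix products stay atoms
    for [ring]. *)
Ltac mx_additive :=
  let k := fresh "k" in let l := fresh "l" in
  apply/matrixP => k l; rewrite !(addmxE, oppmxE); ring.

(** * Rounding errors of the residual and of its projection onto the current block *)

Section Recurrence.
Context (R : realType) (n : nat) (u theta : R) (fl : fl_ops R) (A : 'M[R]_n)
  (a : ot_consts R) (D : blocks R n) (i : nat).
Local Notation V := (bV D i).
Local Notation Vm := (bV D i.-1).
Local Notation B := (bB D i).
Local Notation W := (bV D i.+1).
Local Notation Bn := (bB D i.+1).
Local Notation Y := (Ystored fl A D i).
Local Notation Ai := (Acoef fl A D i).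
Local Notation Ri := (Rres fl A D i).

Lemma Acoef_sym : Ai = Ai^T.
Proof.
apply/matrixP => k l; rewrite !mxE; case: (leqP k l) => kl; last by rewrite ltnW.
case: (leqP l k) => // lk; suff -> : k = l by [].
by apply/val_inj/eqP; rewrite eqn_leq kl.
Qed.

(** The defect in the recurrence before truncation, with [Ri] in place of the next-block term; it
    collects the rounding made in forming [Ri]. *)
Definition step_error : 'M[R]_(n, br D i) := A *m V - Vm *m B^T - V *m Ai - Ri.

Lemma step_error_le : arithmetic_assumption u fl A D i ->
  norm2 step_error <= eps_R u fl A D i.
Proof.
case=> _ [accY _ accP accQ] accR _.
(* One summand per floating-point operation: the product [Y], the two stored products, and the pair
   of subtractions. *)
have -> : step_error = - (Y - A *m V)
    + ((Pminus fl D i - Vm *m B^T) + (Pzero fl A D i - V *m Ai)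
       - (Ri - (Y - Pminus fl D i - Pzero fl A D i))).
  by rewrite /step_error; mx_additive.
rewrite (le_trans (norm2_leD _ _)) // norm2N lerD //; first exact: norm2_le_abs.
apply: norm2_le_abs; apply: lemx_absD; last by rewrite absmxN.
by apply: lemx_absD => //; rewrite -absmx_tr.
Qed.

Lemma projected_error_le : A = A^T -> arithmetic_assumption u fl A D i ->
  norm2 (V^T *m A *m V - Ai) <= eps_alpha u fl A D i.
Proof.
move=> A_sym [_ [accY accH _ _] _ accA].
set H := Ahat fl A D i.
set E := (Y - A *m V); set E2 := H - V^T *m Y.
(* [V^T *m E + E2] is the total error of [H] against [V^T A V]. Since [V^T A V] is its own symmetric
   part, only the symmetric part of that error and the averaging error remain. *)
have -> : V^T *m A *m V - Ai
    = - (2^-1 *: ((V^T *m E + E2) + (V^T *m E + E2)^T))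
      - (Ai - 2^-1 *: (H + H^T)).
  have -> : V^T *m E + E2 = H - V^T *m A *m V.
    by rewrite /E2 /E mulmxBr !mulmxA; mx_additive.
  have S : (V^T *m A *m V)^T = V^T *m A *m V.
    by rewrite !trmx_mul trmxK -A_sym mulmxA.
  rewrite linearB /= S.
  by apply/matrixP => k l; rewrite ![in LHS](addmxE, oppmxE) !mxE; field.
rewrite (le_trans (norm2_leD _ _)) // !norm2N lerD //.
  rewrite (le_trans (norm2_sym_part_le _)) //.
  rewrite (le_trans (norm2_leD _ _)) // lerD //.
    by rewrite norm2M_le ?norm2_tr // norm2_le_abs.
  by apply: norm2_le_abs; rewrite -absmx_tr.
apply: norm2_le_abs => k l; rewrite !mxE.
case: (leqP k l) => [kl|/ltnW lk].
  by have := accA k l kl; rewrite mulrC.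
(* Below the diagonal the entry is the average computed for the transposed position, so the bound is
   used there and its two arguments are exchanged. *)
have := accA l k lk; rewrite [X in _ <= _ * X]addrC [X in _ - X / _]addrC.
by rewrite [_ / 2]mulrC.
Qed.

Lemma projected_residual_le : A = A^T -> arithmetic_assumption u fl A D i ->
  norm2 (V^T *m Ri) <= rho_minus D i + eps_alpha u fl A D i
    + delta D i * norm2 Ai + Num.sqrt (1 + delta D i) * eps_R u fl A D i.
Proof.
move=> A_sym acc.
(* Splitting [V^T V A_i] into [A_i] plus a loss-of-orthogonality term pairs [A_i] with [V^T A V];
   the previous-block term is the transpose of the product measured by [rho_minus]. *)
have -> : V^T *m Ri = (- (B *m Vm^T *m V)^T + (V^T *m A *m V - Ai))
    - (V^T *m V - 1%:M) *m Ai - V^T *m step_error.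
  rewrite /step_error !mulmxBr mulmxBl mul1mx !trmx_mul trmxK !mulmxA.
  by mx_additive.
rewrite (le_trans (norm2_leD _ _)) // norm2N lerD //; last first.
  by rewrite norm2M_le ?norm2_tr ?norm2_gram_le ?step_error_le.
rewrite (le_trans (norm2_leD _ _)) // norm2N lerD ?norm2M //.
by rewrite (le_trans (norm2_leD _ _)) // norm2N norm2_tr lerD ?projected_error_le.
Qed.

Lemma tau_ge0 : 0 <= theta * u -> 0 <= tau u theta fl A D i.
Proof. by move=> tu; rewrite mulr_ge0 // !le_max norm2_ge0. Qed.

(** * QR factor, truncation errors and the next block *)

Section Truncation.
Context (Hot : ortho_trunc u theta fl A D a i).
Local Notation Q := (ot_Q Hot).
Local Notation Qp := (ot_Qperp Hot).
Local Notation C := (ot_C Hot).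
Local Notation G := (ot_G Hot).
Local Notation EH := (ot_EH Hot).
Local Notation EV := (ot_EV Hot).
Local Notation UJ := (ot_UJ Hot).

Lemma ot_Q_gram : [/\ Q^T *m Q = 1%:M, Q^T *m Qp = 0 & Qp^T *m Qp = 1%:M].
Proof.
have [] := ot_Q_orth Hot; rewrite tr_row_mx mul_col_row scalar_mx_block => h _.
by have [-> -> _ ->] := eq_block_mx h.
Qed.

Lemma ot_C_eq : C = Q^T *m (Ri + EH).
Proof.
by have := ot_CG Hot; rewrite tr_row_mx mul_col_mx => /eq_col_mx[].
Qed.

Lemma ot_G_eq : G = Qp^T *m (Ri + EH).
Proof.
by have := ot_CG Hot; rewrite tr_row_mx mul_col_mx => /eq_col_mx[].
Qed.

(** Uses the completeness half of orthogonality, that [row_mx Q Qp] times its transpose is the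
    identity. *)
Lemma range_split : Q *m C + Qp *m G = Ri + EH.
Proof.
have [_ h] := ot_Q_orth Hot.
by rewrite -mul_row_col (ot_CG Hot) mulmxA h mul1mx.
Qed.

Lemma norm2_perturbed_residual_le : norm2 (Ri + EH) <= (1 + aH a) * norm2 Ri.
Proof.
by rewrite (le_trans (norm2_leD _ _)) // mulrDl mul1r lerD ?(ot_EH_le Hot).
Qed.

Lemma norm2_G_le : norm2 G <= (1 + aH a) * norm2 Ri.
Proof.
have [_ _ h] := ot_Q_gram; rewrite ot_G_eq.
by rewrite (le_trans (norm2_isometry_trmul _ h)) ?norm2_perturbed_residual_le.
Qed.

Lemma norm2_Bnext_le : norm2 Bn <= (1 + aS a) * norm2 G.
Proof.
have [[_ _ _ aS0] _ _ _ _] := ot_consts_ge0 Hot.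
have K0 : 0 <= (1 + aS a) * norm2 G by rewrite mulr_ge0 ?norm2_ge0 ?addr_ge0.
have [r0|/(ot_Bnext Hot)[]//] := posnP (br D i.+1).
(* The remaining case is [r_(i+1) = 0]: [Bn] has no rows, so its norm is an empty sum. *)
apply: norm2_le => // x; have -> : vnorm2 (Bn *m x) = 0; last first.
  by rewrite mulr_ge0 ?vnorm2_ge0.
by rewrite /vnorm2 big1 ?sqrtr0 // => k; have := ltn_ord k; rewrite {2}r0.
Qed.

(** [Q] is an isometry, so [R11 x] is as long as [(V + EV) x]. The two terms of [ell_qr] bound [V x]
    from below and [EV x] from above. *)
Lemma ot_R11_bounded_below : delta D i < 1 / 2 -> forall x,
  ell_qr D a i * vnorm2 x <= vnorm2 (ot_R11 Hot *m x).
Proof.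
move=> d12 x; have [QQ _ _] := ot_Q_gram.
rewrite -(vnorm2_isometry (ot_R11 Hot *m x) QQ) mulmxA -(ot_qr Hot).
have d1 : delta D i <= 1 by move: d12; lra.
have hV := vnorm2_gram_ge x d1.
have [[aV0 _ _ _] _ _ _ _] := ot_consts_ge0 Hot.
have hE : norm2 EV <= aV a * Num.sqrt (1 + delta D i).
  by rewrite (le_trans (ot_EV_le Hot)) // ler_wpM2l ?norm2_gram_le.
have hEx : vnorm2 (EV *m x) <= aV a * Num.sqrt (1 + delta D i) * vnorm2 x.
  by rewrite (le_trans (vnorm2_mulmx_le _ _)) // ler_wpM2r ?vnorm2_ge0.
have := vnorm2_leD (V *m x + EV *m x) (- (EV *m x)).
rewrite addrK vnorm2N -mulmxDl /ell_qr mulrBl.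
by rewrite -/(delta D i) in hV; lra.
Qed.

Lemma norm2_C_le : A = A^T -> arithmetic_assumption u fl A D i ->
  delta D i < 1 / 2 -> 0 < ell_qr D a i -> norm2 C <= c_bound u fl A D a i.
Proof.
move=> A_sym acc d12 l0.
have [[aV0 aH0 _ _] _ _ _ _] := ot_consts_ge0 Hot.
have [R11U R11i] := unitmx_bounded_below l0 (ot_R11_bounded_below d12).
have [QQ _ _] := ot_Q_gram.
have eQ : Q = (V + EV) *m invmx (ot_R11 Hot).
  by rewrite (ot_qr Hot) mulmxK.
(* Only the [Ri] part goes through the inverse of [R11]; [EH] stays under the isometry [Q], which is
   why its term in [c_bound] has no factor [kappa]. *)
have -> : C = (invmx (ot_R11 Hot))^T *m (V^T *m Ri + EV^T *m Ri) + Q^T *m EH.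
  by rewrite ot_C_eq mulmxDr {1}eQ trmx_mul -mulmxA linearD /= mulmxDl.
rewrite (le_trans (norm2_leD _ _)) // lerD //; last first.
  by rewrite (le_trans (norm2_isometry_trmul _ QQ)) ?(ot_EH_le Hot).
rewrite norm2M_le ?norm2_tr // (le_trans (norm2_leD _ _)) // lerD //.
  exact: projected_residual_le.
rewrite norm2M_le ?norm2_tr // (le_trans (ot_EV_le Hot)) //.
by rewrite ler_wpM2l ?norm2_gram_le.
Qed.

(** Because [Q^T Qp = 0], the exact factor [Q R11] drops out of [V^T Qp] and only [- EV^T Qp]
    survives. No division by a singular value of the coupling occurs. *)
Lemma norm2_VtW_le : norm2 (V^T *m W) <=
  aV a * norm2 V * Num.sqrt (1 + aU a) + aM a * norm2 V.
Proof.
have [_ QQp QpQp] := ot_Q_gram.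
have -> : V^T *m W = - (EV^T *m Qp *m UJ) + V^T *m ot_EM Hot.
  rewrite (ot_Vnext Hot) mulmxDr mulmxA; congr (_ + _).
  have -> : V^T = (ot_R11 Hot)^T *m Q^T - EV^T.
    by rewrite -trmx_mul -(ot_qr Hot) linearD /= addrK.
  by rewrite mulmxBl -(mulmxA _ Q^T) QQp mulmx0 sub0r mulNmx.
rewrite (le_trans (norm2_leD _ _)) // norm2N lerD //.
  rewrite norm2M_le ?norm2_gram_le ?(ot_UJ_orth Hot) //.
  (* Transposing turns [EV^T Qp] into [Qp^T EV], to which the isometry bound applies. *)
  rewrite -norm2_tr trmx_mul trmxK (le_trans (norm2_isometry_trmul _ QpQp)) //.
  exact: ot_EV_le.
by rewrite mulrC norm2M_le ?norm2_tr ?(ot_EM_le Hot).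
Qed.

(** Expanding the Gram matrix of [Qp UJ + E] with [Qp^T Qp = I] leaves the defect of [UJ], a cross
    term with its transpose, and [E^T E]: the three summands of [eta_next]. *)
Lemma next_gram_le : norm2 (W^T *m W - 1%:M) <= eta_next a.
Proof.
have [_ _ QpQp] := ot_Q_gram; set E := ot_EM Hot.
have eW : W^T *m W - 1%:M
    = (UJ^T *m UJ - 1%:M) + (UJ^T *m (Qp^T *m E) + (UJ^T *m (Qp^T *m E))^T) + E^T *m E.
  have -> : W^T = UJ^T *m Qp^T + E^T.
    by rewrite (ot_Vnext Hot) linearD /= trmx_mul.
  rewrite (ot_Vnext Hot) mulmxDl !mulmxDr !trmx_mul !trmxK !mulmxA.
  rewrite -[UJ^T *m Qp^T *m Qp]mulmxA QpQp mulmx1 -/E.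
  by mx_additive.
have EM : norm2 E <= aM a := ot_EM_le Hot.
have x : norm2 (UJ^T *m (Qp^T *m E)) <= Num.sqrt (1 + aU a) * aM a.
  rewrite norm2M_le ?norm2_tr ?norm2_gram_le ?(ot_UJ_orth Hot) //.
  by rewrite (le_trans (norm2_isometry_trmul _ QpQp)).
rewrite eW (le_trans (norm2_leD _ _)) // lerD //; last first.
  by rewrite expr2 norm2M_le ?norm2_tr.
rewrite (le_trans (norm2_leD _ _)) // lerD ?(ot_UJ_orth Hot) //.
rewrite (le_trans (norm2_leD _ _)) // norm2_tr; lra.
Qed.

Lemma tail_le : 0 <= theta * u ->
  norm2 (ot_UD Hot *m ot_SigmaD Hot *m (ot_ZD Hot)^T)
  <= kappa_tail a * tau u theta fl A D i.
Proof.
move=> tu; rewrite /kappa_tail mulrAC.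
rewrite norm2M_le ?norm2_tr ?norm2_gram_le ?(ot_ZD_orth Hot) //.
rewrite norm2M_le ?norm2_gram_le ?(ot_UD_orth Hot) //.
apply: norm2_diag_le; [exact: tau_ge0|exact: ot_SigmaD_diag|exact: ot_SigmaD_range].
Qed.

(** The witness for the residual matrix of the theorem, forced by the recurrence itself. *)
Definition recurrence_error : 'M[R]_(n, br D i) :=
  A *m V - Vm *m B^T - V *m Ai - W *m Bn.

Lemma recurrence_error_le : 0 <= theta * u -> A = A^T ->
  arithmetic_assumption u fl A D i -> delta D i < 1 / 2 -> 0 < ell_qr D a i ->
  norm2 recurrence_error <= c_bound u fl A D a i + h_bound fl A D a i
    + kappa_tail a * tau u theta fl A D i + eps_R u fl A D i.
Proof.
move=> tu A_sym acc d12 l0; have [QQ _ QpQp] := ot_Q_gram.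
have [[_ aH0 _ aS0] aM0 _ _ _] := ot_consts_ge0 Hot.
set T := ot_UD Hot *m ot_SigmaD Hot *m (ot_ZD Hot)^T.
(* The four groups match the bound: [Q C] gives [c_bound], the bracket of backward errors [h_bound],
   the discarded part [T] the [tau] term, and [step_error] the term [eps_R]. *)
have -> : recurrence_error = Q *m C - (EH - Qp *m ot_ES Hot + ot_EM Hot *m Bn)
    + Qp *m T + step_error.
  have -> : step_error = recurrence_error + W *m Bn - Ri.
    by rewrite /step_error /recurrence_error; mx_additive.
  have -> : Ri = Q *m C + Qp *m G - EH by rewrite range_split addrK.
  rewrite (ot_G_split Hot) !mulmxDr (ot_Vnext Hot) mulmxDl !mulmxA.
  mx_additive.
rewrite (le_trans (norm2_leD _ _)) // lerD ?step_error_le //.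
rewrite (le_trans (norm2_leD _ _)) // lerD //; last first.
  by rewrite (le_trans (norm2_isometry_mul _ QpQp)) ?tail_le.
rewrite (le_trans (norm2_leD _ _)) // norm2N lerD //.
  by rewrite (le_trans (norm2_isometry_mul _ QQ)) ?norm2_C_le.
have hG := norm2_G_le.
(* The three summands of [h_bound] belong to [EH], [Qp ES] and [EM Bn] in turn; [hG] converts the
   norm of [G] into that of [Ri]. *)
rewrite /h_bound !mulrDl.
rewrite (le_trans (norm2_leD _ _)) // lerD //.
  rewrite (le_trans (norm2_leD _ _)) // norm2N lerD ?(ot_EH_le Hot) //.
  rewrite (le_trans (norm2_isometry_mul _ QpQp)) // (le_trans (ot_ES_le Hot)) //.
  by rewrite -mulrA ler_wpM2l.
rewrite -!mulrA norm2M_le ?(ot_EM_le Hot) // (le_trans norm2_Bnext_le) //.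
by rewrite ler_wpM2l ?addr_ge0.
Qed.

End Truncation.
End Recurrence.

Theorem theorem5 (R : realType) (n : nat) (u theta : R) (fl : fl_ops R)
  (A : 'M[R]_n) (a : ot_consts R) (D : blocks R n) (i : nat)
  (u_gt0 : 0 < u) (theta_gt0 : 0 < theta) (A_sym : A = A^T) (i_ge1 : (1 <= i)%N)
  (Harith : arithmetic_assumption u fl A D i)
  (Hot : ortho_trunc u theta fl A D a i)
  (Hdelta : delta D i < 1 / 2) (Heta : eta_next a < 1 / 2) (Hell : 0 < ell_qr D a i) :
  [/\ Acoef fl A D i = (Acoef fl A D i)^T,
      exists F : 'M[R]_(n, br D i),
        A *m bV D i = bV D i.-1 *m (bB D i)^T + bV D i *m Acoef fl A D i
                      + bV D i.+1 *m bB D i.+1 + F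
        /\ norm2 F <= c_bound u fl A D a i + h_bound fl A D a i
                      + kappa_tail a * tau u theta fl A D i + eps_R u fl A D i,
      Num.max (norm2 (bB D i.+1 *m (bV D i)^T *m bV D i.+1))
              (norm2 ((bV D i)^T *m bV D i.+1 *m bB D i.+1)) <= q_bound D a i
    & norm2 ((bV D i.+1)^T *m bV D i.+1 - 1%:M) <= eta_next a < 1 / 2].
Proof.
split; first exact: Acoef_sym.
- exists (recurrence_error fl A D i); split.
    by rewrite /recurrence_error; mx_additive.
  by apply: recurrence_error_le => //; rewrite ltW ?mulr_gt0.
- have VtW := norm2_VtW_le Hot.
  (* Both products are [V^T W] multiplied by the coupling, on the left or on the right, so one bound
     serves twice; the commutation puts the factors of the first bound in matching order. *)
  rewrite ge_max -mulmxA /q_bound {1}mulrC.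
  by rewrite !norm2M_le.
- by rewrite (next_gram_le Hot).
Qed.
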